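(* Let $M$ be a contact sub-Riemannian manifold of dimension $2m+1$ with contact distribution $\Delta$, orthonormal horizontal frame $X_1,\dots,X_{2m}$, Reeb field $X_{2m+1}$ and structural functions $c_{ij}^k$ given by $[X_i,X_j]=-\sum_{k=1}^{2m+1}c_{ij}^kX_k$. Let $W\subset M$ be a smooth hypersurface with singular set $\Sigma$ and horizontal normal $\nu=\sum_{i=1}^{2m}\nu_iX_i$. Then the minimal surface equation $(d\circ i_\nu\mu)|_{W\setminus\Sigma}=0$ is equivalent to $$\left[\sum_{i=1}^{2m}X_i\nu_i+\sum_{i=1}^{2m}\nu_i\Big(\sum_{j=1}^{2m+1}c_{ij}^j\Big)\right]\Bigg|_{W\setminus\Sigma}=0 .$$
   Context: $\Delta\subset TM$ is a smooth rank-$2m$ distribution with a smooth family of inner products, for which $X_1,\dots,X_{2m}$ is an orthonormal frame. The canonical $1$-form $\omega$ is defined up to sign by $\ker\omega=\Delta$ and $\sum_{i<j\le 2m}d\omega(X_i,X_j)^2=1$; contact means $(d\omega)^m\wedge\omega$ is nowhere zero. The Reeb field $X_{2m+1}$ satisfies $\omega(X_{2m+1})=1$ and $d\omega(v,X_{2m+1})=0$ for all $v\in\Delta$. The canonical volume form is $\mu=\theta_1\wedge\dots\wedge\theta_{2m+1}$, where $\{\theta_i\}$ is the coframe dual to $\{X_i\}$ (so $\theta_{2m+1}=\omega$). $\Sigma=\{q\in W:T_qW=\Delta_q\}$. On $W\setminus\Sigma$ the horizontal normal $\nu$ is the unit horizontal field maximizing $\int_\Omega i_X\mu$ among unit horizontal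 fields $X$, for $\Omega\subset W$; equivalently, it is the normalized orthogonal projection to $\Delta$ of the unit normal of $W$ for the Riemannian metric making $X_1,\dots,X_{2m+1}$ orthonormal. To take derivatives, $\nu$ is extended to a smooth unit horizontal field near $W\setminus\Sigma$ (the expressions on $W\setminus\Sigma$ do not depend on the unit horizontal extension). *)

(* Defs.v *)
From mathcomp Require Import all_boot all_order all_algebra perm.
From mathcomp Require Import all_classical all_reals.
From mathcomp Require Import topology normedtype derive.
Set Implicit Arguments.
Unset Strict Implicit.
Unset Printing Implicit Defensive.
Import Order.TTheory GRing.Theory Num.Theory.
Import numFieldNormedType.Exports.
Local Open Scope classical_set_scope.
Local Open Scope ring_scope.

(* f is C^infinity on the open set A: f and all its iterated directional
   derivatives are (Frechet) differentiable, hence continuous, on A. *)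
Definition smooth_on (R : realType) (n : nat) (V : normedModType R)
    (A : set 'rV[R]_n) (f : 'rV[R]_n -> V) : Prop :=
  forall (vs : seq 'rV[R]_n) (x : 'rV[R]_n), A x ->
    differentiable (foldr (fun v (h : 'rV[R]_n -> V) y => 'D_v h y) f vs) x.

(* A Hausdorff, second countable smooth manifold of dimension n without
   boundary. The atlas is indexed by the points: [chart p] is a chart whose
   domain contains p and [unchart p] is its inverse (values outside
   [dom p], resp. [cimg p], are irrelevant). *)
Record manifold (R : realType) (n : nat) := Manifold {
  pts :> topologicalType;
  dom : pts -> set pts;
  chart : pts -> pts -> 'rV[R]_n;
  unchart : pts -> 'rV[R]_n -> pts;
  cimg := fun p => chart p @` dom p;
  hausdorff_pts : hausdorff_space pts;
  second_countable_pts : @second_countable pts;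
  dom_open : forall p, open (dom p);
  dom_center : forall p, dom p p;
  cimg_open : forall p, open (cimg p);
  chartK : forall p q, dom p q -> unchart p (chart p q) = q;
  chart_continuous : forall p q, dom p q -> {for q, continuous (chart p)};
  unchart_continuous : forall p x, cimg p x -> {for x, continuous (unchart p)};
  transition_smooth : forall p q,
    smooth_on (chart p @` (dom p `&` dom q)) (chart q \o unchart p) }.

Section Calculus.
Variables (R : realType) (n : nat) (M : manifold R n).

(* The tangent space at q is 'rV[R]_n: a tangent vector at q is given by its
   coordinates in the chart attached to q. *)
Local Notation T := 'rV[R]_n.

(* Coordinates, in the chart attached to p, of the vector v tangent at q. *)
Definition to_chart (p q : M) (v : T) : T :=
  'D_v (chart p \o unchart q) (chart q q).

(* Vector tangent at q whose coordinates in the chart attached to p are w. *)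
Definition of_chart (p q : M) (w : T) : T :=
  'D_w (chart q \o unchart p) (chart p q).

Definition smooth_fun (U : set M) (f : M -> R) : Prop :=
  forall p, smooth_on (chart p @` (dom p `&` U)) (f \o unchart p).

(* v f, for v tangent at p *)
Definition vder (f : M -> R) (p : M) (v : T) : R :=
  'D_v (f \o unchart p) (chart p p).

(* Local representative of the vector field Y in the chart attached to p. *)
Definition vf_rep (Y : M -> T) (p : M) (x : T) : T :=
  to_chart p (unchart p x) (Y (unchart p x)).

Definition smooth_vf (U : set M) (Y : M -> T) : Prop :=
  forall p, smooth_on (chart p @` (dom p `&` U)) (vf_rep Y p).

(* [Y, Z] = DZ(Y) - DY(Z) in coordinates, so [Y, Z] f = Y(Z f) - Z(Y f). *)
Definition bracket (Y Z : M -> T) (p : M) : T :=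
  'D_(Y p) (vf_rep Z p) (chart p p) - 'D_(Z p) (vf_rep Y p) (chart p p).

(* A k-form assigns to q a function of k vectors tangent at q; k-linearity
   and smoothness are required separately of the 1-forms given as data. *)
Definition kform (k : nat) := M -> ('I_k -> T) -> R.

(* Coefficient of eta, in the chart attached to p, on the constant vectors w. *)
Definition form_rep (k : nat) (eta : kform k) (p : M) (w : 'I_k -> T) (x : T)
    : R :=
  eta (unchart p x) (fun j => of_chart p (unchart p x) (w j)).

Definition smooth_form (k : nat) (eta : kform k) : Prop :=
  forall p w, smooth_on (cimg p) (form_rep eta p w).

Definition one_form (eta : kform 1) : Prop :=
  (forall p, scalar (fun v : T => eta p (fun=> v))) /\ smooth_form eta.

(* Exterior derivative at p, computed in the chart attached to p on the
   constant extensions of the arguments; normalized so that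
   d eta (Y, Z) = Y (eta Z) - Z (eta Y) - eta [Y, Z] for 1-forms. *)
Definition ext_d (k : nat) (eta : kform k) : kform k.+1 := fun p v =>
  \sum_(i < k.+1) (-1) ^+ i *
    'D_(v i) (form_rep eta p (fun j => v (lift i j))) (chart p p).

(* Interior product i_Y eta. *)
Definition int_prod (k : nat) (Y : M -> T) (eta : kform k.+1) : kform k :=
  fun p v => eta p (fun i => if unlift ord0 i is Some j then v j else Y p).

(* Normalized so that (a /\ b)(u, v) = a(u) b(v) - a(v) b(u) for 1-forms. *)
Definition wedge (k l : nat) (a : kform k) (b : kform l) : kform (k + l) :=
  fun p v => ((k`! * l`!)%N%:R)^-1 *
    \sum_(s : 'S_(k + l)) (-1) ^+ s *
      a p (fun i => v (s (lshift l i))) * b p (fun j => v (s (rshift k j))).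

Fixpoint wedge_pow (k : nat) (a : kform k) (m : nat) : kform (m * k) :=
  if m is m'.+1 then wedge a (@wedge_pow k a m') else fun _ _ => 1.

Fixpoint wedge_all (k : nat) : ('I_k -> kform 1) -> kform k :=
  if k is k'.+1
  then fun th => wedge (th ord0) (wedge_all (fun i => th (lift ord0 i)))
  else fun _ _ _ => 1.

(* g is an inner product on the subspace V (irrelevant outside V). *)
Definition inner_product (V : {vspace T}) (g : T -> T -> R) : Prop :=
  [/\ {in V &, forall u v, g u v = g v u},
      forall a, {in V & V & V, forall u v w,
                  g (a *: u + v) w = a * g u w + g v w}
    & {in V, forall u, u != 0 -> 0 < g u u}].

(* f is a defining function of W on the open neighbourhood N of q. *)
Definition defining_fun (W : set M) (q : M) (N : set M) (f : M -> R) : Prop :=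
  [/\ open N, N q, smooth_fun N f, exists v, vder f q v != 0
    & forall p, N p -> (W p <-> f p = 0)].

(* Smooth embedded hypersurface *)
Definition hypersurface (W : set M) : Prop :=
  forall q, W q -> exists N f, defining_fun W q N f.

Definition tangent_to (W : set M) (q : M) (v : T) : Prop :=
  exists N f, defining_fun W q N f /\ vder f q v = 0.

(* Sigma: the points of W at which W is tangent to D. *)
Definition singular_set (D : M -> {vspace T}) (W : set M) : set M :=
  [set q | W q /\ forall v, tangent_to W q v <-> v \in D q].

(* w is the normalized orthogonal projection to D q of a unit normal u of W,
   with respect to the Riemannian metric G. *)
Definition horizontal_normal_at (D : M -> {vspace T}) (G : M -> T -> T -> R)
    (W : set M) (q : M) (w : T) : Prop :=
  exists u h : T,
    [/\ forall v, tangent_to W q v -> G q u v = 0,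
        G q u u = 1,
        h \in D q /\ (forall v, v \in D q -> G q (u - h) v = 0)
      & w = (Num.sqrt (G q h h))^-1 *: h].

End Calculus.
Arguments wedge_pow {R n M k} a m.

Section Contact.
Variables (R : realType) (m : nat) (M : manifold R (2 * m).+1).
Local Notation T := 'rV[R]_(2 * m).+1.

(* Index of the i-th horizontal field in the frame X_1, ..., X_(2m+1), whose
   last element (index ord_max) is the Reeb field. *)
Definition hor (i : 'I_(2 * m)) : 'I_(2 * m).+1 := widen_ord (leqnSn _) i.

Definition ext_d1 (w : kform M 1) (p : M) (u v : T) : R :=
  ext_d w p (fun i : 'I_2 => [:: u; v]`_i).

(* The normalization forces 0 < m. *)
Record contact_subriemannian (D : M -> {vspace T}) (g : M -> T -> T -> R)
    (X : 'I_(2 * m).+1 -> M -> T) (omega : kform M 1) : Prop := {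
  frame_smooth : forall i, smooth_vf setT (X i);
  frame_basis : forall p, basis_of (D p) [seq X (hor i) p | i <- enum 'I_(2 * m)];
  metric_inner : forall p, inner_product (D p) (g p);
  metric_smooth : forall (U : set M) (Y Z : M -> T), open U ->
    smooth_vf U Y -> smooth_vf U Z ->
    (forall p, U p -> Y p \in D p /\ Z p \in D p) ->
    smooth_fun U (fun p => g p (Y p) (Z p));
  frame_orthonormal : forall p i j,
    g p (X (hor i) p) (X (hor j) p) = (i == j)%:R;
  contact_one_form : one_form omega;
  contact_ker : forall p v, omega p (fun=> v) = 0 <-> v \in D p;
  contact_normalized : forall p,
    \sum_(i < 2 * m) \sum_(j < 2 * m | (i < j)%N)
      (ext_d1 omega p (X (hor i) p) (X (hor j) p)) ^+ 2 = 1;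
  contact_nondegenerate : forall p, exists v,
    wedge (wedge_pow (ext_d omega) m) omega p v != 0;
  reeb_omega : forall p, omega p (fun=> X ord_max p) = 1;
  reeb_ext_d : forall p v, v \in D p -> ext_d1 omega p v (X ord_max p) = 0 }.

Definition structural_functions (X : 'I_(2 * m).+1 -> M -> T)
    (c : 'I_(2 * m).+1 -> 'I_(2 * m).+1 -> 'I_(2 * m).+1 -> M -> R) : Prop :=
  forall i j p, bracket (X i) (X j) p = - \sum_k c i j k p *: X k p.

Definition dual_coframe (X : 'I_(2 * m).+1 -> M -> T)
    (theta : 'I_(2 * m).+1 -> kform M 1) : Prop :=
  forall i, one_form (theta i) /\
    forall p j, theta i p (fun=> X j p) = (i == j)%:R.

(* mu = theta_1 /\ ... /\ theta_(2m+1) *)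
Definition volume_form (theta : 'I_(2 * m).+1 -> kform M 1)
    : kform M (2 * m).+1 := wedge_all theta.

(* G is the Riemannian metric for which X_1, ..., X_(2m+1) is orthonormal. *)
Definition frame_metric (X : 'I_(2 * m).+1 -> M -> T) (G : M -> T -> T -> R)
    : Prop :=
  forall p, inner_product fullv (G p) /\
    forall i j, G p (X i p) (X j p) = (i == j)%:R.

(* nu is a horizontal normal of W along W \ Sigma, extended to a smooth unit
   horizontal field on the open neighbourhood U of W \ Sigma, with components
   nui in the horizontal frame. *)
Record horizontal_normal (D : M -> {vspace T}) (g G : M -> T -> T -> R)
    (X : 'I_(2 * m).+1 -> M -> T) (W U : set M) (nu : M -> T)
    (nui : 'I_(2 * m) -> M -> R) : Prop := {
  hn_open : open U;
  hn_nbhd : W `\` singular_set D W `<=` U;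
  hn_smooth : smooth_vf U nu;
  hn_horizontal : forall p, U p -> nu p \in D p;
  hn_unit : forall p, U p -> g p (nu p) (nu p) = 1;
  hn_components : forall p, U p ->
    nu p = \sum_(i < 2 * m) nui i p *: X (hor i) p;
  hn_normal : forall q, (W `\` singular_set D W) q ->
    horizontal_normal_at D G W q (nu q) }.

End Contact.

(* Main.v *)
Require Import Defs.
From HB Require Import structures.
From mathcomp Require Import all_boot all_order all_algebra fingroup perm.
From mathcomp Require Import all_classical all_reals topology normedtype derive.
Set Implicit Arguments.
Unset Strict Implicit.
Unset Printing Implicit Defensive.
Import Order.TTheory GRing.Theory Num.Theory.
Import numFieldNormedType.Exports.
Local Open Scope classical_set_scope.
Local Open Scope ring_scope.

(** In the chart centred at q let A be the matrix of the coframe theta on the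
    coordinate vectors and N the representative of nu. Then mu has density
    det A and d (i_nu mu) = (D_N (det A) + det A * div N) dx, so the minimal
    surface equation says that the bracketed factor vanishes at q.
    Differentiating F A = 1, where the rows F_j of F represent the frame, gives
    D_N (det A) = - det A * sum_j theta_j (D_N F_j); computing div N as a trace
    in the frame, with N = sum_i nu_i F_i, the factor becomes det A times
    sum_i X_i nu_i + sum_i nu_i sum_j theta_j (D_(F_j) F_i - D_(F_i) F_j),
    and theta_j (- [X_i, X_j]) = c_ij^j. Since det A <> 0, the two equations
    are equivalent at each point. *)

(** * Derivatives of products, sums and determinants *)

(** Iterated Leibniz rule. Each summand stays a full product with one factor differentiated, the
    shape of a determinant with one row differentiated. *)
Lemma is_derive_prod (R : realType) (V : normedModType R) (n : nat)
    (f : 'I_n -> V -> R) (df : 'I_n -> R) (x v : V) :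
  (forall i, is_derive x v (f i) (df i)) ->
  is_derive x v (fun y => \prod_i f i y)
    (\sum_i \prod_j (if j == i then df j else f j x)).
Proof.
elim: n f df => [|n IHn] f df Hf.
  rewrite big_ord0; under eq_fun do rewrite big_ord0.
  exact: is_derive_cst.
under eq_fun do rewrite big_ord_recl.
apply: (is_derive_eq
  (is_deriveM (Hf ord0) (IHn _ _ (fun i => Hf (lift ord0 i))))).
rewrite addrC big_ord_recl big_ord_recl /= !scaler_sumr; congr (_ + _).
  by rewrite [LHS]mulrC.
apply: eq_bigr => i _; rewrite big_ord_recl /=; congr (_ * _).
Qed.

Lemma is_derive_bigsum (R : realType) (V W : normedModType R) (I : Type)
    (r : seq I) (P : pred I) (f : I -> V -> W) (df : I -> W) (x v : V) :
  (forall i, is_derive x v (f i) (df i)) ->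
  is_derive x v (fun y => \sum_(i <- r | P i) f i y) (\sum_(i <- r | P i) df i).
Proof.
move=> Hf; elim: r => [|i r IHr].
  by rewrite big_nil; under eq_fun do rewrite big_nil; exact: is_derive_cst.
rewrite big_cons; under eq_fun do rewrite big_cons.
by case: (P i) => //; exact: is_deriveD.
Qed.

(** Jacobi's formula: differentiating the permutation expansion gives a sum of determinants with one
    row differentiated, and each is expanded along that row. *)
Lemma is_derive_det (R : realType) (V : normedModType R) (n : nat)
    (B : V -> 'M[R]_n) (x v : V) :
  (forall i j, derivable (fun y => B y i j) x v) ->
  is_derive x v (fun y => \det (B y))
    (\sum_i \sum_j 'D_v (fun y => B y i j) x * cofactor (B x) i j).
Proof.
move=> dB.
pose dBx i :=
  \matrix_(k, j) (if k == i then 'D_v (fun y => B y k j) x else B x k j).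
have -> : \sum_i \sum_j 'D_v (fun y => B y i j) x * cofactor (B x) i j =
          \sum_i \det (dBx i).
  apply: eq_bigr => i _; rewrite (expand_det_row (dBx i) i).
  apply: eq_bigr => j _; rewrite !mxE eqxx; congr (_ * (_ * \det _)).
  by apply/matrixP => k l; rewrite !mxE eq_sym (negPf (neq_lift _ _)).
rewrite /determinant exchange_big /=.
apply: is_derive_bigsum => s.
have H := is_derive_prod (fun j => derivableP (dB j (s j))).
apply: (is_derive_eq (is_deriveZ ((-1) ^+ s : R) H)).
rewrite [LHS]mulr_sumr; apply: eq_bigr => j _; congr (_ * _).
by apply: eq_bigr => k _; rewrite mxE.
Qed.

Lemma derive_linear_dir (R : realType) (V W : normedModType R) (f : V -> W)
    (x : V) : differentiable f x -> linear (fun v => 'D_v f x).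
Proof. by move=> df a u v; rewrite !deriveE // linearP. Qed.

Lemma derive_sum_dir (R : realType) (V W : normedModType R) (f : V -> W) (x : V)
    (I : finType) (a : I -> R) (u : I -> V) : differentiable f x ->
  'D_(\sum_i a i *: u i) f x = \sum_i a i *: 'D_(u i) f x.
Proof.
move=> df; rewrite deriveE // linear_sum; apply: eq_bigr => i _.
by rewrite linearZ -deriveE.
Qed.

Lemma derive_partials (R : realType) (n : nat) (W : normedModType R)
    (f : 'rV[R]_n -> W) (x v : 'rV[R]_n) : differentiable f x ->
  'D_v f x = \sum_k v 0 k *: 'D_(delta_mx 0 k) f x.
Proof. by move=> df; rewrite {1}(row_sum_delta v) derive_sum_dir. Qed.

Lemma differentiable_entry (R : realType) (V : normedModType R) (m n : nat)
    (f : V -> 'M[R]_(m, n)) (x : V) i j :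
  differentiable f x -> differentiable (fun y => f y i j) x.
Proof.
move=> df; apply: (differentiable_comp (g := fun M : 'M[R]_(m, n) => M i j) df).
exact: differentiable_coord.
Qed.

Lemma derive_entry (R : realType) (V : normedModType R) (m n : nat)
    (f : V -> 'M[R]_(m, n)) (x v : V) i j :
  differentiable f x -> 'D_v f x i j = 'D_v (fun y => f y i j) x.
Proof. by move=> df; rewrite derive_mx ?mxE //; exact: diff_derivable. Qed.

(** * Exterior derivative of a contracted volume form in coordinates *)

(* The row [w] on top of [V] with its row [i] deleted *)
Definition contraction_mx (R : Type) (n : nat) (V : 'M[R]_n.+1) (i : 'I_n.+1)
    (w : 'rV[R]_n.+1) : 'M[R]_n.+1 :=
  \matrix_(a, b) if unlift ord0 a is Some j then V (lift i j) b else w 0 b.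

(** Laplace expansion along the top row: the minors are those of [V] along row [i], and the
    cofactors differ by the sign [(-1) ^+ i]. *)
Lemma det_contraction_mx (R : comNzRingType) (n : nat) (V : 'M[R]_n.+1) i w :
  \det (contraction_mx V i w) = (-1) ^+ i * \sum_k w 0 k * cofactor V i k.
Proof.
rewrite (expand_det_row _ ord0) mulr_sumr; apply: eq_bigr => k _.
rewrite !mxE unlift_none [RHS]mulrCA; congr (_ * _).
rewrite /cofactor add0n exprD mulrA mulrA -expr2 sqrr_sign mul1r.
congr (_ * \det _); apply/matrixP => a b.
by rewrite !mxE liftK.
Qed.

(** The left side is the exterior derivative of i_N (det A dx) on the rows of [V]; the right side is
    det V times the divergence of det A * N, split by the Leibniz rule. *)
Lemma ext_d_volume_contraction (R : realType) (n : nat)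
    (A : 'rV[R]_n.+1 -> 'M[R]_n.+1) (N : 'rV[R]_n.+1 -> 'rV[R]_n.+1)
    (x : 'rV[R]_n.+1) (V : 'M[R]_n.+1) :
  (forall i j, differentiable (fun y => A y i j) x) -> differentiable N x ->
  \sum_(i < n.+1) (-1) ^+ i *
    'D_(row i V) (fun y => \det (contraction_mx V i (N y) *m A y)) x =
  \det V * ('D_(N x) (fun y => \det (A y)) x +
            \det (A x) * \sum_k 'D_(delta_mx 0 k) N x 0 k).
Proof.
move=> dA dN.
have dN1 k : differentiable (fun y => N y 0 k) x by exact: differentiable_entry.
have ddetA w := is_derive_det (fun i j => diff_derivable (v := w) (dA i j)).
(* Linearity in the direction is read off the cofactor formula, entry by entry. *)
have detA_lin w : 'D_w (fun y => \det (A y)) x =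
    \sum_k w 0 k * 'D_(delta_mx 0 k) (fun y => \det (A y)) x.
  rewrite derive_val; under [RHS]eq_bigr do rewrite derive_val mulr_sumr.
  rewrite [RHS]exchange_big; apply: eq_bigr => i _ /=.
  under [RHS]eq_bigr do rewrite mulr_sumr.
  rewrite [RHS]exchange_big; apply: eq_bigr => j _ /=.
  rewrite derive_partials // mulr_suml; apply: eq_bigr => k _.
  by rewrite [RHS]mulrA.
(* The determinant is a combination of the products det A * N_k with coefficients independent of
   [y], so only these products are differentiated. *)
have step i w : 'D_w (fun y => \det (contraction_mx V i (N y) *m A y)) x =
    (-1) ^+ i * \sum_k cofactor V i k *
      ('D_w (fun y => \det (A y)) x * N x 0 k +
       \det (A x) * 'D_w (fun y => N y 0 k) x).
  pose f k y := cofactor V i k * (\det (A y) * N y 0 k).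
  have df k : is_derive x w (f k) (cofactor V i k *
      ('D_w (fun y => \det (A y)) x * N x 0 k +
       \det (A x) * 'D_w (fun y => N y 0 k) x)).
    have dNk := derivableP (diff_derivable (v := w) (dN1 k)).
    apply: (is_derive_eq (is_deriveZ _ (is_deriveM (ddetA w) dNk))).
    rewrite addrC; congr (_ * (_ + _)).
    by rewrite [LHS]mulrC (@derive_val _ _ _ _ _ _ _ (ddetA w)).
  have dF := is_derive_bigsum (index_enum 'I_n.+1) xpredT df.
  apply: etrans (@derive_val _ _ _ _ _ _ _ (is_deriveZ ((-1) ^+ i : R) dF)).
  congr ('D_w _ x); apply/funext => y.
  rewrite det_mulmx det_contraction_mx [RHS]/GRing.scale /= -mulrA; congr (_ * _).
  by rewrite mulr_suml; apply: eq_bigr => k _; rewrite mulrC mulrA [RHS]mulrC.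
under eq_bigr => i _.
  rewrite step mulrA -expr2 sqrr_sign mul1r.
  under eq_bigr => k _.
    rewrite detA_lin derive_partials // mulr_suml [in X in _ + X]mulr_sumr.
    rewrite -big_split /= mulr_sumr.
    under eq_bigr => l _ do rewrite !mxE.
    over.
  rewrite exchange_big /=.
  over.
rewrite exchange_big /=.
(* The identity adj V * V = det V discards the terms that differentiate N_k in a direction l other
   than k. *)
have adjE k l : \sum_i V i l * cofactor V i k = (k == l)%:R * \det V.
  have /matrixP/(_ k l) := mul_adj_mx V; rewrite !mxE mulrb mulr_natl mulrb => <-.
  by apply: eq_bigr => i _; rewrite mxE mulrC.
transitivity (\sum_l \sum_k (\sum_i V i l * cofactor V i k) *
   ('D_(delta_mx 0 l) (fun y => \det (A y)) x * N x 0 k +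
    \det (A x) * 'D_(delta_mx 0 l) (fun y => N y 0 k) x)).
  apply: eq_bigr => l _; rewrite exchange_big /=; apply: eq_bigr => k _.
  rewrite mulr_suml; apply: eq_bigr => i _.
  move: (cofactor V i k) (\det (A x)) => C detA; rewrite -[RHS]mulrA [RHS]mulrCA.
  by congr (_ * _); rewrite mulrDr [_ *: _]/(_ * _) -mulrA [detA * _]mulrCA.
rewrite detA_lin mulr_sumr -big_split mulr_sumr /=; apply: eq_bigr => l _.
rewrite (bigD1 l) //= adjE eqxx mul1r big1 ?addr0.
  by rewrite derive_entry // [in RHS]mulrC [in LHS]mulrC [N x 0 l * _]mulrC.
by move=> k /negPf kl; rewrite adjE kl !mul0r.
Qed.

(** * Density and divergence in a moving frame *)

Lemma is_derive_dot (R : realType) (V : normedModType R) (n : nat)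
    (f g : 'I_n -> V -> R) (x v : V) :
  (forall i, derivable (f i) x v) -> (forall i, derivable (g i) x v) ->
  is_derive x v (fun y => \sum_i f i y * g i y)
    (\sum_i ('D_v (f i) x * g i x + f i x * 'D_v (g i) x)).
Proof.
move=> df dg; apply: is_derive_bigsum => i.
apply: (is_derive_eq (is_deriveM (derivableP (df i)) (derivableP (dg i)))).
by rewrite addrC [g i x *: _]mulrC.
Qed.

(** As P inverts A, adj A = det A * P, so Jacobi's formula gives det A * tr (P dA); differentiating
    P A = 1 turns tr (P dA) into - tr (dP A). *)
Lemma derive_det_dual (R : realType) (n : nat) (V : normedModType R)
    (A P : V -> 'M[R]_n) (x v : V) :
  (\forall y \near x, P y *m A y = 1%:M) ->
  (forall i j, differentiable (fun y => A y i j) x) ->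
  (forall i j, differentiable (fun y => P y i j) x) ->
  'D_v (fun y => \det (A y)) x =
  - (\det (A x) * \sum_j \sum_i 'D_v (fun y => P y j i) x * A x i j).
Proof.
move=> PA dA dP.
have PAx := nbhs_singleton PA.
have cofA i j : cofactor (A x) i j = \det (A x) * P x j i.
  have : \adj (A x) = \det (A x) *: P x.
    by rewrite -[LHS]mulmx1 -(mulmx1C PAx) mulmxA mul_adj_mx mul_scalar_mx.
  by move/matrixP/(_ j i); rewrite !mxE.
have dA' i j := diff_derivable (v := v) (dA i j).
have dP' i j := diff_derivable (v := v) (dP i j).
rewrite (@derive_val _ _ _ _ _ _ _ (is_derive_det dA')) exchange_big /=.
rewrite mulr_sumr -sumrN; apply: eq_bigr => j _.
under eq_bigr do rewrite cofA mulrCA; rewrite -mulr_sumr -mulrN; congr (_ * _).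
have := @derive_val _ _ _ _ _ _ _ (is_derive_dot (dP' j) (dA' ^~ j)).
(* The diagonal entry [j] of P A is constant near [x]. *)
rewrite (_ : 'D_v _ x = 0); last first.
  rewrite -[RHS](derive_cst ((j == j)%:R : R) x v); apply: near_eq_derive.
  near=> y; have /matrixP/(_ j j) : P y *m A y = 1%:M by near: y.
  by rewrite !mxE.
rewrite big_split /= => /esym/eqP; rewrite addrC addr_eq0 => /eqP <-.
by apply: eq_bigr => i _; rewrite mulrC.
Unshelve. all: by end_near. Qed.

(** Invariance of the trace: the divergence is the trace of the derivative of [N], taken here in the
    basis of rows of [P], whose dual basis is the columns of [A]. *)
Lemma divergence_in_frame (R : realType) (n : nat) (N : 'rV[R]_n -> 'rV[R]_n)
    (A P : 'M[R]_n) (x : 'rV[R]_n) : P *m A = 1%:M -> differentiable N x ->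
  \sum_k 'D_(delta_mx 0 k) N x 0 k = \sum_j ('D_(row j P) N x *m A) 0 j.
Proof.
move=> /mulmx1C AP dN.
have AP_ki k i : \sum_j A i j * P j k = (i == k)%:R.
  by have /matrixP/(_ i k) := AP; rewrite !mxE.
transitivity (\sum_j \sum_k \sum_i A i j * P j k * 'D_(delta_mx 0 k) N x 0 i).
  rewrite exchange_big; apply: eq_bigr => k _ /=.
  rewrite exchange_big /= (bigD1 k) //= [X in _ + X]big1 ?addr0 => [|i /negPf ik].
    by rewrite -mulr_suml AP_ki eqxx mul1r.
  by rewrite -mulr_suml AP_ki ik mul0r.
apply: eq_bigr => j _; rewrite mxE exchange_big; apply: eq_bigr => i _ /=.
rewrite derive_partials // summxE mulr_suml; apply: eq_bigr => k _.
by rewrite 2!mxE [RHS]mulrC mulrA.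
Qed.

(* Both sides are [\det A] times the divergence of [N] for the volume form of
   density [\det A], in coordinates and in the frame [F] respectively. *)
Lemma frame_divergence (R : realType) (n k : nat) (e : 'I_k -> 'I_n)
    (A : 'rV[R]_n -> 'M[R]_n) (F : 'I_n -> 'rV[R]_n -> 'rV[R]_n)
    (N : 'rV[R]_n -> 'rV[R]_n) (h : 'I_k -> 'rV[R]_n -> R) (x : 'rV[R]_n) :
  (\forall y \near x, forall j, F j y *m A y = delta_mx 0 j) ->
  (\forall y \near x, N y = \sum_i h i y *: F (e i) y) ->
  (forall i j, differentiable (fun y => A y i j) x) ->
  (forall j, differentiable (F j) x) -> differentiable N x ->
  (forall i, differentiable (h i) x) ->
  'D_(N x) (fun y => \det (A y)) x +
    \det (A x) * \sum_l 'D_(delta_mx 0 l) N x 0 l =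
  \det (A x) * (\sum_i 'D_(F (e i) x) (h i) x +
    \sum_i h i x * \sum_j
      (('D_(F j x) (F (e i)) x - 'D_(F (e i) x) (F j) x) *m A x) 0 j).
Proof.
move=> FA Nh dA dF dN dh.
pose P y := \matrix_j F j y.
have PA : \forall y \near x, P y *m A y = 1%:M.
  near=> y; apply/row_matrixP => j; rewrite row_mul rowK row1.
  by have : forall j, F j y *m A y = delta_mx 0 j by near: y.
have PAx := nbhs_singleton PA.
have FAx := nbhs_singleton FA.
have dP i j : differentiable (fun y => P y i j) x.
  under eq_fun do rewrite mxE; exact: differentiable_entry.
have dN_h w : 'D_w N x =
    \sum_i ('D_w (h i) x *: F (e i) x + h i x *: 'D_w (F (e i)) x).
  apply/rowP => l; rewrite derive_entry // summxE.
  have dF' i : derivable (fun y => F (e i) y 0 l) x w.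
    exact/diff_derivable/differentiable_entry.
  have dh' i := diff_derivable (v := w) (dh i).
  have := @derive_val _ _ _ _ _ _ _ (is_derive_dot dh' dF').
  rewrite (_ : 'D_w _ x = 'D_w (fun y => N y 0 l) x) => [->|].
    by apply: eq_bigr => i _; rewrite !mxE derive_entry.
  apply: near_eq_derive; near=> y.
  have -> : N y = \sum_i h i y *: F (e i) y by near: y.
  by rewrite summxE; apply: eq_bigr => i _; rewrite !mxE.
rewrite (derive_det_dual _ PA) // addrC -mulrBr; congr (_ * _).
rewrite (divergence_in_frame PAx) //.
(* The term from the density is the sum of theta_j (D_N F_j), with the direction N expanded in the
   frame. *)
have -> : \sum_j \sum_i 'D_(N x) (fun y => P y j i) x * A x i j =
    \sum_i h i x * \sum_j ('D_(F (e i) x) (F j) x *m A x) 0 j.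
  under [RHS]eq_bigr do rewrite mulr_sumr.
  rewrite [RHS]exchange_big; apply: eq_bigr => j _ /=.
  transitivity (('D_(N x) (F j) x *m A x) 0 j).
    rewrite mxE; apply: eq_bigr => i _; rewrite derive_entry //.
    by congr (_ * _); congr ('D_(N x) _ x); apply/funext => y; rewrite mxE.
  rewrite (nbhs_singleton Nh) derive_sum_dir // mulmx_suml summxE.
  by apply: eq_bigr => i _; rewrite -scalemxAl mxE.
under eq_bigr => j _.
  rewrite rowK dN_h mulmx_suml summxE.
  under eq_bigr => i _ do rewrite mulmxDl -!scalemxAl FAx 4!mxE.
  over.
rewrite exchange_big /= -sumrB -big_split; apply: eq_bigr => i _ /=.
rewrite big_split /= -addrA -[\sum_j h i x * _]mulr_sumr -mulrBr -sumrB.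
congr (_ + _ * _); last by apply: eq_bigr => j _; rewrite mulmxBl !mxE.
(* Where [h i] is differentiated, theta_j (F_(e i)) vanishes unless j = e i. *)
rewrite (bigD1 (e i)) //= !eqxx mulr1 big1 ?addr0 // => j /negPf ij.
by rewrite ij mulr0.
Unshelve. all: by end_near. Qed.

(** * The volume form as a determinant *)

(** By induction, expanding the smaller determinant over permutations t. For fixed t, composition
    with the lift of t permutes ['S_k.+1], so the sum over s is the full determinant; the k! choices
    of t cancel the normalization of [wedge]. *)
Lemma wedge_all_det (R : realType) (n : nat) (M : manifold R n) (k : nat)
    (th : 'I_k -> kform M 1) (p : M) (v : 'I_k -> 'rV[R]_n) :
  wedge_all th p v = \det (\matrix_(a, b) th b p (fun=> v a)).
Proof.
elim: k th v => [|k IHk] th v; first by rewrite det_mx00.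
pose A := \matrix_(a, b) th b p (fun=> v a).
have rshift1 j : rshift 1 j = lift ord0 j by exact: val_inj.
rewrite [LHS]/= /wedge mul1n.
have expand (s : 'S_k.+1) : (-1) ^+ s * th ord0 p (fun i => v (s (lshift k i))) *
      wedge_all (fun i => th (lift ord0 i)) p (fun j => v (s (rshift 1 j))) =
    \sum_(t : 'S_k) (-1) ^+ (lift_perm ord0 ord0 t * s)%g *
      \prod_b A^T b ((lift_perm ord0 ord0 t * s)%g b).
  rewrite IHk -det_tr /determinant mulr_sumr; apply: eq_bigr => t _.
  rewrite odd_permM odd_lift_perm /= signr_addb big_ord_recl.
  rewrite !mxE permM lift_perm_id.
  have -> : (fun i : 'I_1 => v (s (lshift k i))) = (fun=> v (s ord0)).
    by apply/funext => i; rewrite ord1; congr (v (s _)); exact: val_inj.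
  rewrite mulrCA !mulrA -!mulrA; congr (_ * (_ * (_ * _))).
  apply: eq_bigr => b _.
  by rewrite !mxE permM lift_perm_lift rshift1.
rewrite (eq_bigr _ (fun s _ => expand s)) exchange_big /=.
rewrite (eq_bigr (fun=> \det A)) => [|t _]; last first.
  rewrite -det_tr [RHS](reindex_inj (mulgI (lift_perm ord0 ord0 t))).
  by [].
rewrite sumr_const card_Sn -[\det A *+ _]mulr_natl mulKf //.
by rewrite pnatr_eq0 -lt0n fact_gt0.
Qed.

(** * Charts and changes of coordinates *)

Section Charts.
Context (R : realType) (n : nat) (M : manifold R n).
Implicit Types (p q : M) (x v w : 'rV[R]_n).

Lemma cimg_dom q x : cimg q x -> dom q (unchart q x).
Proof. by move=> [p qp <-]; rewrite chartK. Qed.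

Lemma unchartK q x : cimg q x -> chart q (unchart q x) = x.
Proof. by move=> [p qp <-]; rewrite chartK. Qed.

Lemma cimg_chart q p : dom q p -> cimg q (chart q p).
Proof. by exists p. Qed.

(** Lets identities valid on a chart domain or on [U] be used as identities near [x], as derivatives
    require. *)
Lemma near_unchart q x (U : set M) : cimg q x -> open U -> U (unchart q x) ->
  \forall y \near x, cimg q y /\ U (unchart q y).
Proof.
move=> qx oU Ux; apply: filterI.
  exact: (open_nbhs_nbhs (conj (@cimg_open _ _ _ q) qx)).
exact: (unchart_continuous qx (open_nbhs_nbhs (conj oU Ux))).
Qed.

Lemma transition_differentiable p q r : dom p r -> dom q r ->
  differentiable (chart q \o unchart p) (chart p r).
(* The empty list of directions in [smooth_on] gives differentiability of the map itself. *)
Proof. by move=> pr qr; apply: (@transition_smooth _ _ M p q [::]); exists r. Qed.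

Lemma of_chart_linear p q : dom p q -> linear (of_chart p q).
Proof.
move=> pq; apply: derive_linear_dir.
exact: transition_differentiable (dom_center q).
Qed.

(** Chain rule: the two transition maps compose to the identity near the centre of the chart. *)
Lemma of_chartK p q v : dom p q -> of_chart p q (to_chart p q v) = v.
Proof.
move=> pq; have qq := dom_center q.
have dpq := transition_differentiable qq pq.
have dqp := transition_differentiable pq qq.
rewrite /of_chart /to_chart.
have cpq : (chart p \o unchart q) (chart q q) = chart p q by rewrite /= chartK.
transitivity ('D_v ((chart q \o unchart p) \o (chart p \o unchart q)) (chart q q)).
  rewrite [RHS]deriveE; last by apply: differentiable_comp; rewrite ?cpq.
  rewrite diff_comp ?cpq //= -?deriveE //.
rewrite -[RHS](derive_id (chart q q)); apply: near_eq_derive.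
have := near_unchart (cimg_chart qq) (@dom_open _ _ _ p).
rewrite chartK // => /(_ pq); apply: filterS => y [qy py] /=.
by rewrite chartK // unchartK.
Qed.

Lemma of_chart_center q w : of_chart q q w = w.
Proof.
rewrite -[RHS](derive_id (chart q q)); apply: near_eq_derive.
have := near_unchart (cimg_chart (dom_center q)) openT I.
by apply: filterS => y [qy _] /=; rewrite unchartK.
Qed.

End Charts.

(** * The coframe matrix and the exterior derivative of the contracted volume *)

(** Tangent vectors being rows, multiplying one by this matrix on the right lists its values under
    the coframe; the determinant is the density of mu in the chart. *)
Definition coframe_mx (R : realType) (n : nat) (M : manifold R n)
    (theta : 'I_n -> kform M 1) (q : M) (x : 'rV[R]_n) : 'M[R]_n :=
  \matrix_(k, l) form_rep (theta l) q (fun=> delta_mx 0 k) x.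

(** Both [of_chart] and [theta l] are linear at a fixed point, so the coordinate vectors determine
    the value. *)
Lemma of_chart_coframe (R : realType) (n : nat) (M : manifold R n)
    (theta : 'I_n -> kform M 1) (q : M) (x w : 'rV[R]_n) (l : 'I_n) :
  one_form (theta l) -> cimg q x ->
  theta l (unchart q x) (fun=> of_chart q (unchart q x) w) =
  (w *m coframe_mx theta q x) 0 l.
Proof.
move=> [lin_th _] /cimg_dom qx.
pose ch : {linear 'rV[R]_n -> 'rV[R]_n} :=
  HB.pack (of_chart q (unchart q x))
    (GRing.isLinear.Build _ _ _ _ _ (of_chart_linear qx)).
pose th : {scalar 'rV[R]_n} := HB.pack (fun v => theta l (unchart q x) (fun=> v))
  (GRing.isLinear.Build _ _ _ _ _ (lin_th (unchart q x))).
rewrite mxE -[LHS]/(th (ch w)) {1}(row_sum_delta w) !linear_sum.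
by apply: eq_bigr => k _; rewrite !linearZ mxE.
Qed.

Lemma dual_frame_rep (R : realType) (m : nat) (M : manifold R (2 * m).+1)
    (X : 'I_(2 * m).+1 -> M -> 'rV[R]_(2 * m).+1) theta (q : M) x j :
  dual_coframe X theta -> cimg q x ->
  vf_rep (X j) q x *m coframe_mx theta q x = delta_mx 0 j.
Proof.
move=> dual qx; apply/rowP => l; have [th_l th_X] := dual l.
rewrite -of_chart_coframe // of_chartK ?th_X ?mxE ?eqxx //; exact: cimg_dom.
Qed.

Lemma coframe_mx_differentiable (R : realType) (n : nat) (M : manifold R n)
    (theta : 'I_n -> kform M 1) (q : M) (x : 'rV[R]_n) (i j : 'I_n) :
  one_form (theta j) -> cimg q x ->
  differentiable (fun y => coframe_mx theta q y i j) x.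
Proof.
move=> [_ smooth_th] xq; under eq_fun do rewrite mxE.
exact: (smooth_th q (fun=> delta_mx 0 i) [::]).
Qed.

(** Near the centre of the chart, i_nu mu on the arguments other than the i-th is the determinant of
    a contraction matrix times [A], which reduces the claim to the coordinate formula. *)
Lemma ext_d_int_prod_volume (R : realType) (m : nat) (M : manifold R (2 * m).+1)
    (theta : 'I_(2 * m).+1 -> kform M 1) (U : set M)
    (nu : M -> 'rV[R]_(2 * m).+1) (q : M) (v : 'I_(2 * m).+1 -> 'rV[R]_(2 * m).+1) :
  (forall l, one_form (theta l)) -> open U -> smooth_vf U nu -> U q ->
  let A := coframe_mx theta q in let N := vf_rep nu q in let x := chart q q in
  ext_d (int_prod nu (volume_form theta)) q v =
  \det (\matrix_i v i) * ('D_(N x) (fun y => \det (A y)) x +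
     \det (A x) * \sum_k 'D_(delta_mx 0 k) N x 0 k).
Proof.
move=> th1 oU smooth_nu Uq A N x.
have qq := dom_center q; have xq : cimg q x by exists q.
have dA i j := coframe_mx_differentiable i (th1 j) xq.
have dN : differentiable N x by apply: (smooth_nu q [::]); exists q.
rewrite -ext_d_volume_contraction //; apply: eq_bigr => i _.
rewrite rowK; congr (_ * _); apply: near_eq_derive.
have := near_unchart xq (@openT M) I; apply: filterS => y [yq _].
have qy := cimg_dom yq.
rewrite /form_rep /int_prod /volume_form wedge_all_det; congr (\det _).
apply/matrixP => a l; rewrite mxE.
transitivity ((row a (contraction_mx (\matrix_i v i) i (N y)) *m A y) 0 l); last first.
  by rewrite -row_mul mxE.
rewrite -of_chart_coframe //; congr (theta l _ _); apply/funext => _.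
case: (unliftP ord0 a) => [j|] ->.
  congr of_chart; apply/rowP => b.
  by rewrite !mxE liftK mxE.
(* The first slot holds nu itself, rewritten as the image of its chart representative. *)
rewrite -[LHS](of_chartK _ qy); congr of_chart; apply/rowP => b.
by rewrite !mxE unlift_none.
Qed.

(** * Pointwise equivalence of the two equations *)

Lemma hor_inj (m : nat) : injective (@hor m).
Proof. by move=> i j /(congr1 val) ij; apply: val_inj. Qed.

Theorem mainTheorem3 (R : realType) (m : nat) (M : manifold R (2 * m).+1)
    (D : M -> {vspace 'rV[R]_(2 * m).+1})
    (g : M -> 'rV[R]_(2 * m).+1 -> 'rV[R]_(2 * m).+1 -> R)
    (X : 'I_(2 * m).+1 -> M -> 'rV[R]_(2 * m).+1)
    (omega : kform M 1)
    (hM : contact_subriemannian D g X omega)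
    (c : 'I_(2 * m).+1 -> 'I_(2 * m).+1 -> 'I_(2 * m).+1 -> M -> R)
    (hc : structural_functions X c)
    (theta : 'I_(2 * m).+1 -> kform M 1)
    (htheta : dual_coframe X theta)
    (G : M -> 'rV[R]_(2 * m).+1 -> 'rV[R]_(2 * m).+1 -> R)
    (hG : frame_metric X G)
    (W : set M) (hW : hypersurface W)
    (U : set M) (nu : M -> 'rV[R]_(2 * m).+1) (nui : 'I_(2 * m) -> M -> R)
    (hnu : horizontal_normal D g G X W U nu nui) :
  (forall q, (W `\` singular_set D W) q ->
     forall v, ext_d (int_prod nu (volume_form theta)) q v = 0)
  <->
  (forall q, (W `\` singular_set D W) q ->
     \sum_(i < 2 * m) vder (nui i) q (X (hor i) q)
     + \sum_(i < 2 * m) nui i q * (\sum_(j < (2 * m).+1) c (hor i) j j q) = 0).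
Proof.
have th1 l := (htheta l).1.
(* At each point the two expressions differ by a nonzero density and the determinant of the
   arguments. *)
have key q : (W `\` singular_set D W) q -> exists2 d : R, d != 0 & forall v,
    ext_d (int_prod nu (volume_form theta)) q v = \det (\matrix_i v i) * (d *
    (\sum_(i < 2 * m) vder (nui i) q (X (hor i) q)
     + \sum_(i < 2 * m) nui i q * (\sum_(j < (2 * m).+1) c (hor i) j j q))).
  move=> /(hn_nbhd hnu) Uq.
  have oU := hn_open hnu; have smooth_nu := hn_smooth hnu.
  pose A := coframe_mx theta q; pose N := vf_rep nu q; pose x := chart q q.
  pose F j := vf_rep (X j) q; 
  (* The components are recovered as theta_i (nu), so their differentiability comes from that of [N]
     and [A]. *)
  pose h (i : 'I_(2 * m)) y : R := (N y *m A y) 0 (hor i).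
  have qq := dom_center q; have xq : cimg q x by exists q.
  have FA y j : cimg q y -> F j y *m A y = delta_mx 0 j.
    exact: dual_frame_rep.
  have FAx j := FA x j xq.
  have Fx j : F j x = X j q.
    by rewrite /F /vf_rep chartK // -[LHS](of_chart_center q) of_chartK.
  (* The density of mu at [q], nonzero because F A = 1. *)
  exists (\det (A x)).
    have : (\matrix_j F j x) *m A x = 1%:M.
      by apply/row_matrixP => j; rewrite row_mul rowK row1.
    move/(congr1 determinant); rewrite det_mulmx det1 => /eqP.
    by apply: contraTneq => ->; rewrite mulr0 eq_sym oner_eq0.
  move=> v; rewrite (ext_d_int_prod_volume _ th1 oU smooth_nu Uq); congr (_ * _).
  have near_U : \forall y \near x, cimg q y /\ U (unchart q y).
    by apply: near_unchart => //; rewrite chartK.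
  have N_nui y : cimg q y -> U (unchart q y) ->
      N y = \sum_i nui i (unchart q y) *: F (hor i) y.
    move=> yq Uy; have qy := cimg_dom yq.
    rewrite /N /vf_rep (hn_components hnu Uy) /to_chart derive_sum_dir //.
    exact: transition_differentiable (dom_center _) qy.
  have h_nui i y : cimg q y -> U (unchart q y) -> h i y = nui i (unchart q y).
    move=> yq Uy; rewrite /h (N_nui y yq Uy) mulmx_suml summxE (bigD1 i) //=.
    rewrite -scalemxAl FA // !mxE !eqxx mulr1 big1 ?addr0 // => j ji.
    rewrite -scalemxAl FA // !mxE eqxx (inj_eq (@hor_inj m)).
    by rewrite eq_sym (negPf ji) mulr0.
  have dA i j := coframe_mx_differentiable i (th1 j) xq.
  have dN : differentiable N x by apply: (smooth_nu q [::]); exists q.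
  have dF j : differentiable (F j) x.
    by apply: (@frame_smooth _ _ _ _ _ _ _ hM j q [::]); exists q.
  have dh i : differentiable (h i) x.
    rewrite (_ : h i = \sum_j (fun y => N y 0 j * A y j (hor i))).
      apply: differentiable_sum => j; apply: differentiableM => //.
      exact: differentiable_entry.
    by apply/funext => y; rewrite fct_sumE /h mxE.
  rewrite (@frame_divergence _ _ _ (@hor m) _ F _ h) //.
  - congr (_ * (_ + _)); apply: eq_bigr => i _.
      rewrite Fx; apply: near_eq_derive.
      by apply: filterS near_U => y [yq Uy]; exact: h_nui.
    rewrite h_nui ?chartK //; congr (_ * _); apply: eq_bigr => j _; rewrite !Fx.
    (* The difference of derivatives is - [X_i, X_j], the sum of c_ij^k X_k by the sign convention
       for [c]; theta_j selects k = j. *)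
    have := hc (hor i) j q; rewrite /bracket -/(F j) -/(F (hor i)) -/x.
    move/(congr1 -%R); rewrite opprB opprK => ->.
    rewrite mulmx_suml summxE (bigD1 j) //= big1 ?addr0 => [|k kj].
      by rewrite -scalemxAl -Fx FAx !mxE !eqxx mulr1.
    by rewrite -scalemxAl -Fx FAx !mxE eqxx eq_sym (negPf kj) mulr0.
  - by apply: filterS near_U => y [yq _] j; exact: FA.
  - apply: filterS near_U => y [yq Uy]; apply: (etrans (N_nui y yq Uy)).
    by apply: eq_bigr => i _; rewrite h_nui.
split=> H q Wq.
  have [d d0 Hd] := key q Wq.
  (* On the coordinate vectors the determinant of the arguments is 1. *)
  have := H q Wq (fun i => delta_mx 0 i); rewrite Hd.
  rewrite (_ : (\matrix_i _) = 1%:M); last first.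
    by apply/row_matrixP => i; rewrite rowK row1.
  by rewrite det1 mul1r => /eqP; rewrite mulf_eq0 (negPf d0) => /eqP.
by move=> v; have [d d0 ->] := key q Wq; rewrite H // !mulr0.
Qed.
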